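(* Let $I=[T_0,T]$ with $T_0<T$ real, let $n,m$ be positive integers, let $g=(g_1,\dots,g_m):I\times\mathbb R^n\to\mathbb R^m$ be such that $g(t,\cdot)$ is differentiable for each $t\in I$, and put $$C(t)=\{x\in\mathbb R^n: g_1(t,x)\le0,\ g_2(t,x)\le0,\dots,g_m(t,x)\le0\},\qquad t\in I.$$ Let $r\in(0,+\infty]$ be such that all the sets $C(t)$, $t\in I$, are $r$-prox-regular. Assume that there exist an absolutely continuous function $w:I\to\mathbb R$, a real $\delta>0$ and a vector $y\in\mathbb R^n$ with $\|y\|=1$ such that for each $i=1,\dots,m$ $$g_i(t,x)\le g_i(s,x)+|w(t)-w(s)|\quad\text{for all } s,t\in I,\ x\in U_r(C(s)),$$ $$\langle\nabla g_i(t,\cdot)(x),y\rangle\le-\delta\quad\text{for all } t\in I,\ x\in U_r(C(t)).$$ Then $C(\cdot)$ is $\upsilon(\cdot)$-absolutely continuous on $I$ with $\upsilon(\cdot):=\delta^{-1}w(\cdot)$.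
   Context: $\mathbb R^n$ carries the Euclidean inner product and norm; $\mathbb B$ is its closed unit ball. For $S\subset\mathbb R^n$, $d_S(y)=\inf_{z\in S}\|y-z\|$ and $U_r(S):=\{y\in\mathbb R^n: d_S(y)<r\}$. $\nabla g_i(t,\cdot)(x)$ is the gradient at $x$ of the function $g_i(t,\cdot)$. $C(\cdot)$ is $\upsilon(\cdot)$-absolutely continuous on $I$ means that $\upsilon:I\to\mathbb R$ is absolutely continuous and $C(t)\subset C(s)+|\upsilon(s)-\upsilon(t)|\,\mathbb B$ for all $s,t\in I$. The proximal normal cone $N^P_S(x)$ of $S$ at $x\in S$ is the set of $v$ for which there are $\sigma\ge0$, $\delta_0>0$ with $\langle v,z-x\rangle\le\sigma\|z-x\|^2$ for all $z\in S$ with $\|z-x\|<\delta_0$. A closed set $S$ is $r$-prox-regular if for all $x\in S$ and all $0\ne\zeta\in N^P_S(x)$ one has $\langle\zeta/\|\zeta\|,z-x\rangle\le\frac{1}{2r}\|z-x\|^2$ for all $z\in S$ (with $1/r=0$ if $r=+\infty$). *)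

(* Defs.v *)
From HB Require Import structures.
From mathcomp Require Import all_boot all_order all_algebra.
From mathcomp Require Import all_classical all_reals all_analysis.

Set Implicit Arguments.
Unset Strict Implicit.
Unset Printing Implicit Defensive.

Import Order.TTheory GRing.Theory Num.Theory.
Import numFieldNormedType.Exports.

Local Open Scope classical_set_scope.
Local Open Scope ring_scope.

(* The library norm on 'rV[R]_n is the sup norm, so the Euclidean structure
   is defined here; both norms induce the same topology and the same notion of
   differentiability. *)
Definition dotv (R : realType) (n : nat) (u v : 'rV[R]_n) : R :=
  \sum_(i < n) u 0 i * v 0 i.

Definition enorm (R : realType) (n : nat) (v : 'rV[R]_n) : R :=
  Num.sqrt (dotv v v).

Definition eball1 (R : realType) (n : nat) : set 'rV[R]_n :=
  [set v | enorm v <= 1].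

(* The infimum is taken in the extended reals: dist_to set0 y = +oo, so
   that nbhd r set0 = set0 for every r, including r = +oo. *)
Definition dist_to (R : realType) (n : nat) (S : set 'rV[R]_n) (y : 'rV[R]_n)
    : \bar R :=
  ereal_inf [set (enorm (y - z))%:E | z in S].

Definition nbhd (R : realType) (n : nat) (r : \bar R) (S : set 'rV[R]_n)
    : set 'rV[R]_n :=
  [set y | (dist_to S y < r)%E].

Definition gradient (R : realType) (n : nat) (f : 'rV[R]_n -> R)
    (x : 'rV[R]_n) : 'rV[R]_n :=
  \row_j 'D_(delta_mx 0 j) f x.

Definition prox_normal_cone (R : realType) (n : nat) (S : set 'rV[R]_n)
    (x : 'rV[R]_n) : set 'rV[R]_n :=
  [set v | exists sigma delta0 : R, [/\ 0 <= sigma, 0 < delta0 &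
    forall z, S z -> enorm (z - x) < delta0 ->
      dotv v (z - x) <= sigma * enorm (z - x) ^+ 2]].

(* In \bar R, +oo^-1 = 0, which is the convention 1/r = 0 for r = +oo. *)
Definition prox_regular (R : realType) (n : nat) (r : \bar R)
    (S : set 'rV[R]_n) : Prop :=
  closed S /\
  forall x zeta, S x -> zeta != 0 -> prox_normal_cone S x zeta ->
    forall z, S z ->
      ((dotv ((enorm zeta)^-1 *: zeta) (z - x))%:E
        <= (2%:E * r)^-1 * (enorm (z - x) ^+ 2)%:E)%E.

Definition abs_continuous (R : realType) (a b : R) (f : R -> R) : Prop :=
  forall e : R, 0 < e -> exists2 d : R, 0 < d &
    forall (k : nat) (lo hi : 'I_k -> R),
      (forall i, [/\ a <= lo i, lo i <= hi i & hi i <= b]) ->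
      trivIset setT (fun i => `]lo i, hi i[%classic) ->
      \sum_(i < k) (hi i - lo i) < d ->
      \sum_(i < k) `|f (hi i) - f (lo i)| < e.

Definition set_abs_continuous (R : realType) (n : nat) (a b : R)
    (ups : R -> R) (C : R -> set 'rV[R]_n) : Prop :=
  abs_continuous a b ups /\
  forall s t : R, s \in `[a, b] -> t \in `[a, b] ->
    C t `<=` [set c + `|ups s - ups t| *: u | c in C s & u in @eball1 R n].

Definition sublevel (R : realType) (n m : nat)
    (g : R -> 'rV[R]_n -> 'rV[R]_m) (t : R) : set 'rV[R]_n :=
  [set x | forall i : 'I_m, g t x 0 i <= 0].

(* Main.v *)
(* For x in C(t), the mean value theorem shows that each g_i(t, .) decreases
   at rate at least delta along the ray x + a y.  With h = |w(s) - w(t)|, the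
   point c = x + (h / delta) y therefore satisfies g_i(t, c) <= - h, hence
   g_i(s, c) <= 0, and x = c - (h / delta) y. *)
Require Import Defs.
From HB Require Import structures.
From mathcomp Require Import all_boot all_order all_algebra.
From mathcomp Require Import all_classical all_reals all_analysis.
From mathcomp Require Import lra.

Set Implicit Arguments.
Unset Strict Implicit.
Unset Printing Implicit Defensive.

Import Order.TTheory GRing.Theory Num.Theory.
Import numFieldNormedType.Exports.

Local Open Scope classical_set_scope.
Local Open Scope ring_scope.

Lemma dotvZZ (R : realType) (n : nat) (k : R) (v : 'rV[R]_n) :
  dotv (k *: v) (k *: v) = k ^+ 2 * dotv v v.
Proof.
by rewrite /dotv mulr_sumr; apply: eq_bigr => i _; rewrite !mxE mulrACA expr2.
Qed.

Lemma enormZ (R : realType) (n : nat) (k : R) (v : 'rV[R]_n) :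
  enorm (k *: v) = `|k| * enorm v.
Proof. by rewrite /enorm dotvZZ sqrtrM ?sqr_ge0// sqrtr_sqr. Qed.

(** Expand [v] in the canonical basis and use the linearity of the differential. *)
Lemma derive_gradient (R : realType) (n : nat) (f : 'rV[R]_n -> R)
    (x v : 'rV[R]_n) :
  differentiable f x -> 'D_v f x = dotv (gradient f x) v.
Proof.
move=> df; rewrite deriveE// {1}(row_sum_delta v) linear_sum.
by apply: eq_bigr => j _; rewrite linearZ mxE deriveE// mulrC.
Qed.

Lemma is_derive_line (R : realType) (n : nat) (f : 'rV[R]_n -> R)
    (x v : 'rV[R]_n) (a : R) :
  derivable f (x + a *: v) v ->
  is_derive a 1 (fun b : R => f (x + b *: v)) ('D_v f (x + a *: v)).
Proof.
(* The difference quotient of the one-variable function at [a] is that of [f] at [x + a *: v] in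
   direction [v]. *)
have E : (fun h : R => h^-1 *: (f (x + (h *: 1 + a) *: v) - f (x + a *: v))) =
         (fun h : R => h^-1 *: (f (h *: v + (x + a *: v)) - f (x + a *: v))).
  by apply/funext => h; rewrite scalerDl /= [h *: 1]mulr1 addrCA.
move=> df; split; first by rewrite /derivable /= E.
by rewrite /derive /= E.
Qed.

Lemma nbhd_shift (R : realType) (n : nat) (r : \bar R) (S : set 'rV[R]_n)
    (x v : 'rV[R]_n) :
  S x -> ((enorm v)%:E < r)%E -> nbhd r S (x + v).
Proof.
move=> Sx; apply: le_lt_trans; apply: ereal_inf_lbound.
by exists x => //; rewrite addrAC subrr add0r.
Qed.

(** The slope bound is required only on the segment, so the lemma applies to any segment that stays
    inside the neighbourhood where gradients are controlled. *)
Lemma line_decrease (R : realType) (n : nat) (f : 'rV[R]_n -> R)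
    (x v : 'rV[R]_n) (delta a : R) :
  (forall z, differentiable f z) -> 0 <= a ->
  (forall b, 0 <= b <= a -> dotv (gradient f (x + b *: v)) v <= - delta) ->
  f (x + a *: v) <= f x - delta * a.
Proof.
move=> df a0 fd.
have dl (b : R) : is_derive b 1 (fun b : R => f (x + b *: v))
    ('D_v f (x + b *: v)).
  by apply: is_derive_line; exact: diff_derivable.
have [|c cI] := @MVT_segment R (fun b => f (x + b *: v))
  (fun b => 'D_v f (x + b *: v)) 0 a a0
  (fun b _ => dl b).
  apply: continuous_subspaceT => b; apply: differentiable_continuous.
  by apply/derivable1_diffP; case: (dl b).
rewrite scale0r addr0 subr0 => /(canRL (subrK _)) ->.
rewrite addrC lerD2l derive_gradient// -mulNr ler_wpM2r// fd//.
Qed.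

(* A step of length [rho < r] along [v] stays in the neighbourhood and lands
   back in [S], so the steps can be chained over any distance. *)
Lemma ray_decrease (R : realType) (n m : nat) (f : 'rV[R]_n -> 'rV[R]_m)
    (r : \bar R) (v : 'rV[R]_n) (delta : R) :
  let S := [set x | forall i : 'I_m, f x 0 i <= 0] in
  (0 < r)%E -> enorm v = 1 -> 0 <= delta ->
  (forall x, differentiable f x) ->
  (forall i x, nbhd r S x ->
     dotv (gradient (fun z => f z 0 i) x) v <= - delta) ->
  forall x a i, S x -> 0 <= a -> f (x + a *: v) 0 i <= f x 0 i - delta * a.
Proof.
move=> S r0 v1 delta0 df fd.
(* Take half of a finite radius, and 1 when [r] is infinite. *)
have [rho rho0 rhor] : exists2 rho : R, 0 < rho & (rho%:E < r)%E.
  case: r r0 {fd} => [r| |]//.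
  - rewrite lte_fin => r0; exists (r / 2); first exact: divr_gt0.
    by rewrite lte_fin gtr_pMr// invf_lt1// ltr1n.
  - by exists 1 => //; rewrite ltry.
have step x a i : S x -> 0 <= a <= rho ->
    f (x + a *: v) 0 i <= f x 0 i - delta * a.
  move=> Sx /andP[a0 arho].
  apply: (@line_decrease _ _ (fun z => f z 0 i)) => //.
    move=> z; apply: (@differentiable_comp _ _ _ _ f (fun u : 'rV_m => u 0 i)).
      exact: df.
    exact: differentiable_coord.
  move=> b /andP[b0 ba]; apply: fd; apply: nbhd_shift => //.
  rewrite enormZ v1 mulr1 ger0_norm//; apply: le_lt_trans rhor.
  by rewrite lee_fin (le_trans ba).
(* Induction on the number [k] of steps, with the base point general: after a full step the
   induction hypothesis is used from [x + rho *: v] over the remaining length [a - rho]. *)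
have steps k x a i : S x -> 0 <= a <= k%:R * rho ->
    f (x + a *: v) 0 i <= f x 0 i - delta * a.
  elim: k x a => [|k IH] x a Sx /andP[a0 ak].
    by apply: step => //; rewrite a0 (le_trans ak)// mul0r ltW.
  have [arho|/ltW arho] := leP a rho; first by apply: step => //; rewrite a0.
  have rhoI : 0 <= rho <= rho by rewrite lexx ltW.
  (* Every component, not only the [i]-th, is nonpositive at [x] and does not increase, so the new
     base point lies in [S]. *)
  have Sx' : S (x + rho *: v).
    move=> j; apply: (le_trans (step _ _ _ Sx rhoI)).
    by rewrite subr_le0 (le_trans (Sx j))// mulr_ge0// ltW.
  have aI : 0 <= a - rho <= k%:R * rho.
    by rewrite subr_ge0 arho lerBlDr (le_trans ak)// -natr1 mulrDl mul1r.
  have := IH _ _ Sx' aI.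
  rewrite -addrA -scalerDl subrKC => /le_trans; apply.
  have := step x rho i Sx rhoI; rewrite mulrBr; lra.
(* By the Archimedean property finitely many steps cover [a]. *)
move=> x a i Sx a0; apply: (steps (Num.bound (a / rho))) => //.
by rewrite a0 -ler_pdivrMr// ltW// archi_boundP// divr_ge0// ltW.
Qed.

Lemma abs_continuousZ (R : realType) (a b k : R) (f : R -> R) :
  0 < k -> abs_continuous a b f -> abs_continuous a b (fun t => k * f t).
Proof.
move=> k0 fac e e0; have [|d d0 fd] := fac (e / k); first exact: divr_gt0.
exists d => // p lo hi lohi tI s.
have := fd p lo hi lohi tI s; rewrite ltr_pdivlMr// mulr_suml.
apply: le_lt_trans; apply: ler_sum => i _.
by rewrite -mulrBr normrM gtr0_norm// mulrC.
Qed.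

Theorem proposition5p2 (R : realType) (T0 T : R) (T0T : T0 < T) (n m : nat)
    (n_gt0 : (0 < n)%N) (m_gt0 : (0 < m)%N)
    (g : R -> 'rV[R]_n -> 'rV[R]_m)
    (g_diff : forall t x, t \in `[T0, T] -> differentiable (g t) x)
    (r : \bar R) (r_gt0 : (0 < r)%E)
    (C_prox : forall t, t \in `[T0, T] -> prox_regular r (sublevel g t))
    (w : R -> R) (w_ac : abs_continuous T0 T w)
    (delta : R) (delta_gt0 : 0 < delta)
    (y : 'rV[R]_n) (y_unit : enorm y = 1)
    (g_var : forall (i : 'I_m) (s t : R) (x : 'rV[R]_n),
       s \in `[T0, T] -> t \in `[T0, T] -> nbhd r (sublevel g s) x ->
       g t x 0 i <= g s x 0 i + `|w t - w s|)
    (g_grad : forall (i : 'I_m) (t : R) (x : 'rV[R]_n),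
       t \in `[T0, T] -> nbhd r (sublevel g t) x ->
       dotv (gradient (fun z => g t z 0 i) x) y <= - delta) :
  set_abs_continuous T0 T (fun t => delta^-1 * w t) (sublevel g).
Proof.
split; first by apply: abs_continuousZ; rewrite // invr_gt0.
move=> s t sI tI x Cx; set h : R := `|w s - w t|.
have nE : `|delta^-1 * w s - delta^-1 * w t| = h / delta.
  by rewrite -mulrBr normrM gtr0_norm ?invr_gt0// mulrC.
have hd0 : 0 <= h / delta by rewrite divr_ge0 ?normr_ge0// ltW.
have dec a i : 0 <= a -> g t (x + a *: y) 0 i <= g t x 0 i - delta * a.
  apply: (ray_decrease r_gt0 y_unit (ltW delta_gt0)) => // [z|j z].
    exact: g_diff.
  exact: g_grad.
have Cxh : sublevel g t (x + (h / delta) *: y).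
  move=> i; apply: le_trans (dec _ i hd0) _.
  by rewrite subr_le0 (le_trans (Cx i))// mulr_ge0// ltW.
exists (x + (h / delta) *: y).
  move=> i; have := @g_var i _ _ (x + (h / delta) *: y) tI sI.
  (* The variation bound is applied with base time [t]; the shifted point is admissible because it
     lies in [sublevel g t] itself, at distance zero. *)
  have N : nbhd r (sublevel g t) (x + (h / delta) *: y).
    rewrite -[X in nbhd _ _ X]addr0; apply: nbhd_shift => //.
    by rewrite -(scale0r y) enormZ normr0 mul0r.
  (* Moving by [h / delta] gains exactly [h], which absorbs the variation [h] between the times [t]
     and [s]. *)
  move=> /(_ N); have := dec _ i hd0; rewrite mulrCA divff ?gt_eqF// mulr1.
  have := Cx i; rewrite -/h; lra.
exists (- y); first by rewrite /eball1 /= -scaleN1r enormZ normrN1 mul1r y_unit.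
by rewrite nE scalerN addrK.
Qed.
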